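(* Let $p(x)=\prod_{k=0}^{n-1}(x-\alpha_k)\in\mathbb{C}[x]$ with pairwise distinct $\alpha_0,\dots,\alpha_{n-1}$, let $\mathcal{A}=\mathbb{C}[x]/p(x)$, and let $b=\{p_0(x),\dots,p_{n-1}(x)\}$ be a basis of $\mathcal{A}$. Let $r(x)\in\mathcal{A}$, let $\mathcal{B}=\langle r(x)\rangle\le\mathcal{A}$ be the subalgebra generated by $r(x)$, and let $T=\{t_0(x),\dots,t_{L-1}(x)\}\subset\mathcal{A}$ be a transversal of $\mathcal{B}$ in $\mathcal{A}$, i.e. $\mathcal{A}=\bigoplus_{\ell=0}^{L-1}t_\ell(x)\mathcal{B}$ as vector spaces. For $0\le\ell<L$ let $\beta^{(\ell)}$ be the list (in some fixed order, without repetition) of the values $r(\alpha_k)$ over those $k$ with $t_\ell(\alpha_k)\neq 0$, let $m_\ell=|\beta^{(\ell)}|$ and $q^{(\ell)}(y)=\prod_{\beta_j\in\beta^{(\ell)}}(y-\beta_j)$, and let $b^{(\ell)}=\{b^{(\ell)}_0(y),\dots,b^{(\ell)}_{m_\ell-1}(y)\}$ be a basis of $\mathbb{C}[y]/q^{(\ell)}(y)$. Then $$\mathcal{P}_{b,\alpha}=\begin{pmatrix}D_0M_0 &|& D_1M_1&|&\cdots&|&D_{L-1}M_{L-1}\end{pmatrix}\Big(\bigoplus_{\ell=0}^{L-1}\mathcal{P}_{b^{(\ell)},\beta^{(\ell)}}\Big)B,$$ where $B$ is the base change matrix from the basis $b$ to the concatenation of bases $\bigcup_{\ell=0}^{L-1}\{t_\ell(x)b^{(\ell)}_0(r(x)),\dots,t_\ell(x)b^{(\ell)}_{m_\ell-1}(r(x))\}$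 of $\mathcal{A}$; $D_\ell=\mathrm{diag}(t_\ell(\alpha_k))_{0\le k<n}$; and $M_\ell$ is the $n\times m_\ell$ matrix whose $(k,j)$-th element is $1$ if $r(\alpha_k)$ equals the $j$-th element of $\beta^{(\ell)}$, and $0$ otherwise.
   Context: Lists are ordered sets without duplicate elements. Elements of $\mathcal{A}=\mathbb{C}[x]/p(x)$ are polynomials added and multiplied modulo $p(x)$; evaluation at the roots $\alpha_k$ of $p$ is well defined on $\mathcal{A}$. The subalgebra generated by $r(x)$ is $\langle r(x)\rangle=\{\sum_{k\ge0}c_kr^k(x)\bmod p(x)\mid c_k\in\mathbb{C}\}$ (finite sums). For a list of polynomials $b=\{p_0,\dots,p_{n-1}\}$ and a list of points $\alpha=\{\alpha_0,\dots,\alpha_{n-1}\}$, the polynomial transform is the matrix $\mathcal{P}_{b,\alpha}=[p_\ell(\alpha_k)]_{0\le k,\ell<n}$ ($k$ row index, $\ell$ column index); likewise $\mathcal{P}_{b^{(\ell)},\beta^{(\ell)}}$ is the $m_\ell\times m_\ell$ matrix whose $(j,i)$ entry is $b^{(\ell)}_i$ evaluated at the $j$-th element of $\beta^{(\ell)}$. The direct sum $\bigoplus$ of matrices is the block-diagonal matrix. The base change matrix from $b$ to $b'$ is the matrix whose $i$-th column is the coordinate vector of the $i$-th element of $b$ with respect to $b'$. *)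

(* Defs.v *)
From mathcomp Require Import all_boot all_order all_algebra.
From mathcomp Require Import complex reals.

Set Implicit Arguments.
Unset Strict Implicit.
Unset Printing Implicit Defensive.

Import GRing.Theory.
Local Open Scope ring_scope.

Section Definitions.

Variable F : fieldType.

Definition root_poly n (s : n.-tuple F) : {poly F} :=
  \prod_(k < n) ('X - (tnth s k)%:P).

(* The elements of [{poly %/ p}] are stored as their representatives of degree
   less than [deg p], and coerce to them; this is how they are evaluated at
   points. *)

(* F[y]/1 is the zero space, whose basis is the empty list. The case [n = 0] is
   separate because [{poly %/ 1}] is by convention [{poly %/ 'X}], which is
   one-dimensional. *)
Definition quotient_basis n (s : n.-tuple F) m
    (b : m.-tuple {poly %/ root_poly s}) : bool :=
  if n == 0%N then m == 0%N else basis_of fullv b.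

Definition poly_transform m (b : m.-tuple {poly F}) (s : m.-tuple F) : 'M[F]_m :=
  \matrix_(k < m, l < m) (tnth b l).[tnth s k].

Section Subalgebra.

Variable p : {poly F}.
Local Notation A := {poly %/ p}.

(* [horner_alg r c] is the finite sum of the [c`_k *: r ^+ k], computed in [A],
   that is, modulo [p]. *)
Definition generated_subalgebra (r : A) (B : {vspace A}) : Prop :=
  forall f : A, f \in B <-> exists c : {poly F}, f = horner_alg r c.

(* t B = {t f | f in B} *)
Definition mul_vspace (t : A) (B : {vspace A}) : {vspace A} :=
  (linfun (t \*o idfun) @: B)%VS.

Definition subalg_transversal (B : {vspace A}) L (T : L.-tuple A) : Prop :=
  [/\ uniq T,
      (\sum_(l < L) mul_vspace (tnth T l) B)%VS = fullv
    & directv (\sum_(l < L) mul_vspace (tnth T l) B)].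

(* The coordinates in [b'] are those of [vector.coord]; they are only
   meaningful if [b'] is a basis. *)
Definition base_change n n' (b : n.-tuple A) (b' : n'.-tuple A) : 'M[F]_(n', n) :=
  \matrix_(j < n', i < n) coord b' j (tnth b i).

(* The index [j] of the concatenation is the entry [tagnat.sig2 j] of the block
   [tagnat.sig1 j]: the same indexing as for [\mxrow] and [\mxdiag]. *)
Definition concat_bases (r : A) L (T : L.-tuple A) (m : 'I_L -> nat)
    (b : forall l, (m l).-tuple {poly F}) : (\sum_(l < L) m l).-tuple A :=
  [tuple tnth T (tagnat.sig1 j)
         * horner_alg r (tnth (b (tagnat.sig1 j)) (tagnat.sig2 j)) | j < _].

End Subalgebra.

Definition eval_diag n (t : {poly F}) (s : n.-tuple F) : 'M[F]_n :=
  diag_mx (\row_(k < n) t.[tnth s k]).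

Definition incidence_mx n m (r : {poly F}) (s : n.-tuple F) (beta : m.-tuple F) :
    'M[F]_(n, m) :=
  \matrix_(k < n, j < m) (r.[tnth s k] == tnth beta j)%:R.

Definition reps q m (b : m.-tuple {poly %/ q}) : m.-tuple {poly F} :=
  [tuple (tnth b i : {poly F}) | i < m].

End Definitions.

(* Main.v *)
Require Import Defs.
From mathcomp Require Import all_boot all_order all_algebra.
From mathcomp Require Import complex reals.
Set Implicit Arguments.
Unset Strict Implicit.
Unset Printing Implicit Defensive.
Import GRing.Theory.
Local Open Scope ring_scope.

(** An element of [F[x]/p] is determined by its values at the roots of [p].
    Hence [t h(r) = 0] if and only if [h] vanishes at every value [r(alpha_k)]
    with [t(alpha_k) <> 0], so that [h |-> t h(r)] induces an isomorphism from
    [F[y]/q] onto [t B]. It maps a basis of [F[y]/q] to a basis of [t B], and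
    the direct sum decomposition of the algebra makes the concatenation of
    these bases a basis. The matrix factorization then expresses the evaluation
    at [alpha_k] of the expansion of [p_i] in that basis. *)

Lemma big_tagnat (V : nmodType) L (m : 'I_L -> nat)
    (E : forall l, 'I_(m l) -> V) :
  \sum_(j < \sum_(l < L) m l) E (tagnat.sig1 j) (tagnat.sig2 j)
  = \sum_(l < L) \sum_(i < m l) E l i.
Proof. by rewrite sig_big_dep/= (reindex _ tagnat.sig_bij_on). Qed.

(** A vector splits into components in the [U l], and each component is expanded in its block. For
    freeness, directness makes each block of a vanishing combination vanish on its own, and the
    freeness of that block applies. *)
Lemma directv_concat_basis (F : fieldType) (V : vectType F) L (m : 'I_L -> nat)
    (U : 'I_L -> {vspace V}) (X : forall l, (m l).-tuple V) :
    directv (\sum_(l < L) U l) -> (forall l, basis_of (U l) (X l)) ->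
  basis_of (\sum_(l < L) U l)
    [tuple tnth (X (tagnat.sig1 j)) (tagnat.sig2 j) | j < \sum_(l < L) m l].
Proof.
move=> dxU basisX; set Y := [tuple _ | j < _].
have memX l i : tnth (X l) i \in U l.
  exact: (basis_mem (basisX l)) (mem_tnth i (X l)).
apply/andP; split.
  apply/eqP/vspaceP => v; apply/idP/idP => [|/memv_sumP[w Uw ->]].
    move/coord_span=> ->; apply: rpred_sum => j _; apply: rpredZ.
    rewrite -tnth_nth tnth_mktuple.
    by rewrite (subvP (sumv_sup (tagnat.sig1 j) _ (subvv _))).
  under eq_bigr => l _ do
    rewrite (coord_basis (basisX l) (Uw l isT)).
  under eq_bigr => l _ do under eq_bigr => i _ do rewrite -tnth_nth.
  rewrite -(big_tagnat (fun l i => coord (X l) i (w l) *: tnth (X l) i)).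
  apply: rpred_sum => j _; apply: rpredZ; apply: memv_span.
  by apply/tnthP; exists j; rewrite tnth_mktuple.
apply/freeP => k.
(* Writing the argument of [k] as the [Rank] of its block and position lets [big_tagnat] split the
   sum. *)
under eq_bigr => j _ do
  rewrite -tnth_nth tnth_mktuple -{1}(tagnat.sig2K j).
rewrite (big_tagnat (fun l i => k (tagnat.Rank l i) *: tnth (X l) i)).
move=> k0 j; rewrite -(tagnat.sig2K j).
move: (tagnat.sig1 j) (tagnat.sig2 j) => l i {j}.
have {}k0 : \sum_(i < m l) k (tagnat.Rank l i) *: tnth (X l) i = 0.
  move/directv_sum_independent: dxU => /(_ _ _ k0 l isT); apply=> l' _.
  by apply: rpred_sum => i' _; apply: rpredZ.
move: (basis_free (basisX l)) => /freeP/(_ (fun i => k (tagnat.Rank l i))).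
by apply; rewrite -[RHS]k0; apply: eq_bigr => i' _; rewrite -tnth_nth.
Qed.

Section RootPoly.

Variables (F : fieldType) (n : nat) (s : n.-tuple F).

Lemma root_polyE : root_poly s = \prod_(z <- s) ('X - z%:P).
Proof. by rewrite big_tuple. Qed.

Lemma size_root_poly : size (root_poly s) = n.+1.
Proof. by rewrite root_polyE size_prod_XsubC size_tuple. Qed.

(* For [n = 0], [mk_monic] is ['X] instead. *)
Lemma mk_monic_root_poly : (0 < n)%N -> mk_monic (root_poly s) = root_poly s.
Proof.
by move=> n_gt0; rewrite /mk_monic size_root_poly ltnS n_gt0
  root_polyE monic_prod_XsubC.
Qed.

(** Reduction changes [f] by a multiple of the modulus, which for [0 < n] is [root_poly s] and
    vanishes at [z]. *)
Lemma horner_rmodp_root_poly (f : {poly F}) z : (0 < n)%N -> z \in s ->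
  (Pdiv.CommonRing.rmodp f (mk_monic (root_poly s))).[z] = f.[z].
Proof.
move=> n_gt0 sz.
have monic_s := monic_mk_monic (root_poly s).
rewrite [in RHS](Pdiv.RingMonic.rdivp_eq monic_s f) hornerD hornerM.
suff /rootP-> : root (mk_monic (root_poly s)) z by rewrite mulr0 add0r.
by rewrite mk_monic_root_poly // root_polyE root_prod_XsubC.
Qed.

(** The difference of the representatives has degree less than [n] and vanishes at [n] distinct
    points. *)
Lemma qpoly_eval_inj (f g : {poly %/ root_poly s}) : (0 < n)%N -> uniq s ->
    {in s, forall z, (f : {poly F}).[z] = (g : {poly F}).[z]} ->
  f = g.
Proof.
move=> n_gt0 s_uniq fg; apply/val_inj/eqP; rewrite -subr_eq0; apply/eqP.
apply: (roots_geq_poly_eq0 (rs := s)) => //.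
  by apply/allP => z sz; rewrite rootE hornerD hornerN subr_eq0 (fg z sz).
rewrite -ltnS; apply: leq_trans (size_mk_monic (f - g)) _.
by rewrite mk_monic_root_poly // size_root_poly size_tuple.
Qed.

Lemma horner_qpolyM (f g : {poly %/ root_poly s}) z : (0 < n)%N -> z \in s ->
  (f * g : {poly F}).[z] = (f : {poly F}).[z] * (g : {poly F}).[z].
Proof. by move=> n_gt0 sz; rewrite horner_rmodp_root_poly // hornerM. Qed.

Lemma horner_horner_alg (r : {poly %/ root_poly s}) (c : {poly F}) z :
    (0 < n)%N -> z \in s ->
  (horner_alg r c : {poly F}).[z] = c.[(r : {poly F}).[z]].
Proof.
move=> n_gt0 sz; elim/poly_ind: c => [|c a IHc].
  by rewrite rmorph0 !horner0.
rewrite rmorphD rmorphM /= horner_algX horner_algC hornerD horner_qpolyM // IHc.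
by rewrite poly_of_qpolyZ !hornerE.
Qed.

(** Spanning is expressed through values on [s], and so is freeness in the next lemma: in this form
    both also hold for [n = 0], where there are no points. For [0 < n], the residue class of [f] is
    expanded in [b]. *)
Lemma quotient_basis_eval_span m (b : m.-tuple {poly %/ root_poly s})
    (f : {poly F}) : quotient_basis b ->
  exists u : 'I_m -> F, {in s, forall z,
    f.[z] = \sum_(i < m) u i * (tnth b i : {poly F}).[z]}.
Proof.
rewrite /quotient_basis; case: (posnP n) => [n0|n_gt0 basis_b].
  by exists (fun=> 0) => z /tnthP[k _]; have := ltn_ord k; rewrite {2}n0.
pose g : {poly %/ root_poly s} := in_qpoly (root_poly s) f.
exists (fun i => coord b i g) => z sz.
have -> : f.[z] = (g : {poly F}).[z] by rewrite horner_rmodp_root_poly.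
rewrite [in LHS](coord_basis basis_b (memvf g)) raddf_sum /= horner_sum.
by apply: eq_bigr => i _; rewrite hornerZ -tnth_nth.
Qed.

Lemma quotient_basis_eval_free m (b : m.-tuple {poly %/ root_poly s})
    (u : 'I_m -> F) : uniq s -> quotient_basis b ->
    {in s, forall z, \sum_(i < m) u i * (tnth b i : {poly F}).[z] = 0} ->
  forall i, u i = 0.
Proof.
move=> s_uniq; rewrite /quotient_basis; case: (posnP n) => [n0 /eqP m0 _ i|].
  by have := ltn_ord i; rewrite {2}m0.
move=> n_gt0 /basis_free/freeP free_b u0; apply: free_b.
apply: qpoly_eval_inj => // z sz; rewrite horner0 -[RHS](u0 z sz).
rewrite raddf_sum /= horner_sum.
by apply: eq_bigr => i _; rewrite hornerZ -tnth_nth.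
Qed.

End RootPoly.

(** If [t] does not vanish at the point, row [k] of the incidence matrix has exactly one entry 1,
    which selects the row of the transform at the value of [r]. Otherwise the diagonal factor makes
    both sides zero. *)
Lemma eval_diag_incidence_poly_transformE (F : fieldType) n m (s : n.-tuple F)
    (beta : m.-tuple F) (t r : {poly F}) (b : m.-tuple {poly F}) k i :
    uniq beta -> (t.[tnth s k] != 0 -> r.[tnth s k] \in beta) ->
  (eval_diag t s *m incidence_mx r s beta *m poly_transform b beta) k i
  = t.[tnth s k] * (tnth b i).[r.[tnth s k]].
Proof.
move=> beta_uniq t_beta; rewrite -mulmxA mul_diag_mx !mxE.
have [->|/t_beta/tnthP[j rj]] := eqVneq t.[tnth s k] 0; first by rewrite !mul0r.
congr (_ * _); rewrite (bigD1 j) //= !mxE rj eqxx mul1r big1 ?addr0 //.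
move=> j' j'j; rewrite !mxE rj (inj_eq (tuple_uniqP _ beta_uniq)).
by rewrite eq_sym (negPf j'j) mul0r.
Qed.

Section Block.

Variables (F : fieldType) (n : nat) (alpha : n.-tuple F).
Hypotheses (n_gt0 : (0 < n)%N) (alpha_uniq : uniq alpha).

Local Notation A := {poly %/ root_poly alpha}.

Variables (r : A) (B : {vspace A}).
Hypothesis B_gen : generated_subalgebra r B.

Variables (t : A) (m : nat) (beta : m.-tuple F).
Hypothesis beta_uniq : uniq beta.
Hypothesis beta_values : forall z, z \in beta <->
  exists k : 'I_n, (t : {poly F}).[tnth alpha k] != 0
                   /\ z = (r : {poly F}).[tnth alpha k].

Lemma mul_vspaceP f :
  f \in mul_vspace t B <-> exists c : {poly F}, f = t * horner_alg r c.
Proof.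
split=> [/memv_imgP[g /B_gen[c ->] ->]|[c ->]].
  by exists c; rewrite lfunE.
have -> : t * horner_alg r c = linfun (t \*o idfun) (horner_alg r c).
  by rewrite lfunE.
by apply: memv_img; apply/B_gen; exists c.
Qed.

(** The two elements are compared at each [alpha_k]. Where [t] vanishes they agree; elsewhere the
    value of [t] cancels, leaving a condition at [r(alpha_k)], and these values are exactly the
    elements of [beta]. *)
Lemma mul_horner_alg_eq (c d : {poly F}) :
  t * horner_alg r c = t * horner_alg r d <->
  {in beta, forall z, c.[z] = d.[z]}.
Proof.
split=> [cd z /beta_values[k [tk ->]]|cd].
  have mem_k := mem_tnth k alpha.
  move/(congr1 (fun f : A => (f : {poly F}).[tnth alpha k])): cd.
  by rewrite !horner_qpolyM // !horner_horner_alg //; apply: mulfI.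
apply: qpoly_eval_inj => // _ /tnthP[k ->].
have mem_k := mem_tnth k alpha.
rewrite !horner_qpolyM // !horner_horner_alg //.
have [->|tk] := eqVneq (t : {poly F}).[tnth alpha k] 0; first by rewrite !mul0r.
by congr (_ * _); apply: cd; apply/beta_values; exists k.
Qed.

Lemma mul_vspace_basis (b : m.-tuple {poly %/ root_poly beta}) :
    quotient_basis b ->
  basis_of (mul_vspace t B) [tuple t * horner_alg r (tnth b i) | i < m].
Proof.
move=> basis_b; set Y : m.-tuple A := [tuple _ | i < m].
have combY (u : 'I_m -> F) : \sum_(i < m) u i *: tnth Y i
    = t * horner_alg r (\sum_(i < m) u i *: (tnth b i : {poly F})).
  rewrite linear_sum mulr_sumr; apply: eq_bigr => i _.
  by rewrite linearZ /= mulr_algl -scalerAr tnth_mktuple.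
apply/andP; split.
  apply/eqP/vspaceP => f; apply/idP/idP => [/coord_span fE|/mul_vspaceP[c ->]].
    apply/mul_vspaceP; exists (\sum_(i < m) coord Y i f *: (tnth b i : {poly F})).
    by rewrite {1}fE -combY; apply: eq_bigr => i _; rewrite -tnth_nth.
  (* Only the values of [c] on [beta] matter, so a combination of [b] with the same values there can
     replace it. *)
  have [u cu] := quotient_basis_eval_span c basis_b.
  have -> : t * horner_alg r c = \sum_(i < m) u i *: tnth Y i.
    rewrite combY; apply/mul_horner_alg_eq => z /cu->.
    by rewrite horner_sum; apply: eq_bigr => i _; rewrite hornerZ.
  by apply: rpred_sum => i _; apply/rpredZ/memv_span/mem_tnth.
apply/freeP => u; under eq_bigr do rewrite -tnth_nth.
(* Zero is written as the image of the zero polynomial, to compare two elements of the form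
   [t * horner_alg r _]. *)
rewrite combY -[0 in RHS](mulr0 t) -[0 in RHS](rmorph0 (horner_alg r)).
move/mul_horner_alg_eq => u0; apply: quotient_basis_eval_free basis_b _ => //.
move=> z /u0; rewrite horner0 horner_sum => cz0.
by rewrite -[RHS]cz0; apply: eq_bigr => i _; rewrite hornerZ.
Qed.

End Block.

(** Column [j] of the product of the first two factors lists the values on [alpha] of the [j]-th
    element of the concatenation. *)
Lemma poly_transform_decomposition (F : fieldType) (n : nat)
    (alpha : n.-tuple F) (b : n.-tuple {poly %/ root_poly alpha})
    (r : {poly %/ root_poly alpha}) (L : nat)
    (T : L.-tuple {poly %/ root_poly alpha}) (m : 'I_L -> nat)
    (beta : forall l, (m l).-tuple F) (c : forall l, (m l).-tuple {poly F}) :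
    (forall l, uniq (beta l)) ->
    (forall l k, (tnth T l : {poly F}).[tnth alpha k] != 0 ->
       (r : {poly F}).[tnth alpha k] \in beta l) ->
    quotient_basis (concat_bases r T c) ->
  poly_transform (reps b) alpha =
    \mxrow_(l < L) (eval_diag (tnth T l) alpha *m incidence_mx r alpha (beta l))
    *m \mxdiag_(l < L) poly_transform (c l) (beta l)
    *m base_change b (concat_bases r T c).
Proof.
move=> beta_uniq T_beta basis_b'; apply/matrixP => k i.
(* The row index [k] itself excludes [n = 0]. *)
have n_gt0 : (0 < n)%N by apply: leq_ltn_trans (ltn_ord k).
have {}basis_b' : basis_of fullv (concat_bases r T c).
  by move: basis_b'; rewrite /quotient_basis eqn0Ngt n_gt0.
rewrite mul_mxrow_mxdiag [LHS]mxE [RHS]mxE tnth_mktuple.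
rewrite [in LHS](coord_basis basis_b' (memvf (tnth b i))) raddf_sum horner_sum.
apply: eq_bigr => j _; rewrite hornerZ mulrC -tnth_nth tnth_mktuple.
have mem_k := mem_tnth k alpha.
congr (_ * _); last by rewrite mxE.
rewrite horner_qpolyM // horner_horner_alg //.
by rewrite mxE eval_diag_incidence_poly_transformE //; apply: T_beta.
Qed.

Theorem theorem5p1 (R : realType) (n : nat) (alpha : n.-tuple R[i])
    (alpha_uniq : uniq alpha)
    (b : n.-tuple {poly %/ root_poly alpha}) (b_basis : quotient_basis b)
    (r : {poly %/ root_poly alpha})
    (B : {vspace {poly %/ root_poly alpha}}) (B_gen : generated_subalgebra r B)
    (L : nat) (T : L.-tuple {poly %/ root_poly alpha})
    (T_transversal : subalg_transversal B T)
    (m : 'I_L -> nat) (beta : forall l : 'I_L, (m l).-tuple R[i])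
    (beta_uniq : forall l : 'I_L, uniq (beta l))
    (beta_values : forall (l : 'I_L) (z : R[i]),
       z \in beta l <->
       exists k : 'I_n, (tnth T l : {poly R[i]}).[tnth alpha k] != 0
                        /\ z = (r : {poly R[i]}).[tnth alpha k])
    (b_ : forall l : 'I_L, (m l).-tuple {poly %/ root_poly (beta l)})
    (b_basis_ : forall l : 'I_L, quotient_basis (b_ l)) :
  let b' := concat_bases r T (fun l : 'I_L => reps (b_ l)) in
  quotient_basis b' /\
  poly_transform (reps b) alpha =
    \mxrow_(l < L) (eval_diag (tnth T l) alpha *m incidence_mx r alpha (beta l))
    *m \mxdiag_(l < L) poly_transform (reps (b_ l)) (beta l)
    *m base_change b b'.
Proof.
move=> b'; have basis_b' : quotient_basis b'; last first.
  split=> //; apply: poly_transform_decomposition basis_b' => // l k Tk.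
  by apply/beta_values; exists k.
have [_ sumT dxT] := T_transversal.
rewrite /quotient_basis; case: (posnP n) => [n0|n_gt0].
  (* For [n = 0] the concatenation must be empty: an element of some [beta l] would come from an
     index in ['I_0]. *)
  rewrite sum_nat_eq0; apply/forallP => l; apply/implyP => _.
  have [//|ml_gt0] := posnP (m l).
  have /beta_values[k _] := mem_tnth (Ordinal ml_gt0) (beta l).
  by have := ltn_ord k; rewrite {2}n0.
(* Each entry of [b'] is read as an entry of the basis of its block [t_l B]. *)
have -> : b' = [tuple tnth [tuple tnth T (tagnat.sig1 j) * horner_alg r
    (tnth (b_ (tagnat.sig1 j)) i) | i < m (tagnat.sig1 j)] (tagnat.sig2 j) | j < _].
  by apply: eq_from_tnth => j; rewrite !tnth_mktuple.
rewrite -sumT; apply: (directv_concat_basis (X := fun l => [tuple tnth T l *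
    horner_alg r (tnth (b_ l) i) | i < m l]) dxT) => l.
exact: (mul_vspace_basis n_gt0 alpha_uniq B_gen (beta_uniq l)).
Qed.
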